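(* Let $S$ be the set containing 8 copies of each even positive integer and 16 copies of each odd positive integer, and let $T$ be the set containing 16 copies of each even positive integer and 8 copies of each odd positive integer. Let $D_S(N)$ (respectively, $D_T(N)$) be the number of partitions of $N$ into distinct elements of $S$ (respectively, $T$). Then, for every integer $N\geq 1$, $$D_S(N)=16\,D_T(N-1).$$
   Context: A ''set containing several copies'' of certain integers means a set of colored integers: the different copies of the same integer are regarded as distinct (distinguishable) elements, each having that integer as its value. A partition of $N$ into distinct elements of $X$ is a finite subset of $X$ whose elements have values summing to $N$ (so each copy is used at most once, but different copies of the same integer may be used together, and subsets using different copies are counted as different). The empty partition is the unique partition of $0$. No restriction is imposed on the number of parts. *)

(* Defs.v *)
From mathcomp Require Import all_boot finmap.
From mathcomp Require Import mathcomp_extra boolp classical_sets functions cardinality.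

Set Implicit Arguments.
Unset Strict Implicit.
Unset Printing Implicit Defensive.

Local Open Scope classical_set_scope.

(* A colored integer (n, c) is copy number c of the integer n. *)
Definition colored := (nat * nat)%type.
Definition value (x : colored) : nat := x.1.
Definition color (x : colored) : nat := x.2.

(* [e] copies of each even positive integer, [o] copies of each odd one. *)
Definition copies (e o : nat) : set colored :=
  [set x | 0 < value x /\ color x < (if odd (value x) then o else e)].

Definition S_set : set colored := copies 8 16.
Definition T_set : set colored := copies 16 8.

Definition distinct_partitions (X : set colored) (N : nat) :
    set {fset colored} :=
  [set P : {fset colored} | [set` P] `<=` X /\ \sum_(x <- P) value x = N].

(* [fset_set] is empty on infinite sets; [finite_distinct_partitions] below
   shows that this default is not used for [S_set] and [T_set]. *)
Definition num_distinct_partitions (X : set colored) (N : nat) : nat :=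
  #|` fset_set (distinct_partitions X N)|.

Definition D_S : nat -> nat := num_distinct_partitions S_set.
Definition D_T : nat -> nat := num_distinct_partitions T_set.

Lemma finite_distinct_partitions (e o N : nat) :
  finite_set (distinct_partitions (copies e o) N).
Proof.
have Bfin : finite_set (`I_N.+1 `*` `I_(maxn e o)).
  by apply: finite_setX; exact: finite_II.
apply: (@sub_finite_set _ _ [set` fpowerset (fset_set (`I_N.+1 `*` `I_(maxn e o)))]);
  last exact: finite_fset.
move=> P [PX PN] /=; rewrite fpowersetE; apply/fsubsetP => -[n c] Px.
have [_ /= lt_c] : copies e o (n, c) by exact: PX.
rewrite in_fset_set // inE; split=> /=.
  by rewrite ltnS -PN (big_fsetD1 _ Px) leq_addr.
by apply: leq_trans lt_c _; case: ifP => _; rewrite (leq_maxl, leq_maxr).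
Qed.

(* Main.v *)
Require Import Defs.
From mathcomp Require Import all_boot.
From mathcomp Require Import all_order all_algebra zify ring.
From mathcomp Require Import finmap classical_sets cardinality.

(** Put P(q) = prod (1 + q^(2k+2)), O(q) = prod (1 + q^(2k+1)) and
    N(q) = O(-q) (products over k >= 0).  The generating functions of D_S and
    D_T are O^16 P^8 and O^8 P^16, so the claim is

      O^16 P^8 = 1 + 16 q O^8 P^16.

    Euler's identity O N P = 1 turns it, after division by O^8 P^8, into
    Jacobi's aequatio identica satis abstrusa O^8 - N^8 = 16 q P^8.  With
    E(q) = prod (1 - q^(2k+2)), the Jacobi triple product gives

      E O^2 = sum q^(a^2),  E N^2 = sum (-1)^a q^(a^2),
      2 E P^2 = sum q^(a^2 + a)    (sums over all integers a),

    so that Jacobi's identity is the quartic relation between these three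
    theta series ([jacobi_quartic]).  Expanding the fourth powers over vectors
    of Z^4, the left side becomes twice the sum of q^(|v|^2) over the v of odd
    coordinate sum, and the right side the sum of q^(|x|^2) over all
    x in (Z + 1/2)^4.  The isometry

      1/2 [1 1 1 1; 1 1 -1 -1; 1 -1 1 -1; 1 -1 -1 1]

    sends the vectors v onto the x of even coordinate sum, and x_1 -> -x_1
    exchanges those with the x of odd coordinate sum, so each class
    contributes one of the two copies.

    Power series are replaced by polynomials modulo 'X^M, infinite products by
    long finite ones, and the triple product by its finite form, which is the
    q-binomial theorem for an even number of factors
    ([finite_triple_product], [truncated_triple_product]).  The combinatorial
    meaning of the coefficients is [num_distinct_partitions_gf]. *)

Set Implicit Arguments.
Unset Strict Implicit.
Unset Printing Implicit Defensive.

Import GRing.Theory.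
Local Open Scope ring_scope.

(** * The q-binomial theorem *)

Section GaussianBinomials.
Variable R : comNzRingType.
Implicit Types q x y : R.

Fixpoint gbinom q n j : R :=
  match n, j with
  | _, 0 => 1
  | 0, _.+1 => 0
  | n'.+1, j'.+1 => q ^+ (n' - j') * gbinom q n' j' + gbinom q n' j'.+1
  end.

Definition pochhammer q n : R := \prod_(k < n) (1 - q ^+ k.+1).

Lemma gbinom_small q n j : (n < j)%N -> gbinom q n j = 0.
Proof.
elim: n j => [|n IHn] [|j] //= lt_nj.
by rewrite !IHn ?mulr0 ?add0r //; apply: ltnW.
Qed.

(** The q-binomial theorem, homogeneous in [x] and [y] so that negative powers
    of [q] are not needed when it is centred in [finite_triple_product]. *)
Lemma prod_addr_gbinom q x y n :
  \prod_(k < n) (y + x * q ^+ k) =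
  \sum_(j < n.+1) gbinom q n j * q ^+ 'C(j, 2) * x ^+ j * y ^+ (n - j).
Proof.
elim: n => [|n IHn].
  by rewrite big_ord0 big_ord1 bin0n /= !expr0 !mulr1.
rewrite big_ord_recr /= {}IHn mulrDr !mulr_suml.
rewrite [RHS]big_ord_recl [X in X + _ = _]big_ord_recl /= -addrA; congr (_ + _).
  by rewrite !subn0 exprSr; case: n => [|n] /=; rewrite !bin0n; ring.
have -> : \sum_(i < n) gbinom q n (bump 0 i) * q ^+ 'C(bump 0 i, 2) *
      x ^+ bump 0 i * y ^+ (n - bump 0 i) * y =
    \sum_(i < n.+1) gbinom q n i.+1 * q ^+ 'C(i.+1, 2) * x ^+ i.+1 * y ^+ (n - i).
  rewrite big_ord_recr /= gbinom_small // !mul0r addr0; apply: eq_bigr => i _.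
  rewrite /bump leq0n add1n -[(n - i)%N](subnSK (ltn_ord i)).
  by rewrite [y ^+ _.+1]exprSr !mulrA.
rewrite -big_split /=; apply: eq_bigr => i _.
have le_in : (i <= n)%N by rewrite -ltnS.
rewrite /bump leq0n !add1n add0n subSS binS bin1.
have -> : q ^+ n = q ^+ (n - i) * q ^+ i by rewrite -exprD subnK.
by rewrite !exprD exprS; ring.
Qed.

(** The quotient formula for Gaussian binomials in multiplied-out form: it is
    what shows that they tend to the inverse of the infinite product. *)
Lemma pochhammer_gbinom q n j : (j <= n)%N ->
  gbinom q n j * pochhammer q j * pochhammer q (n - j) = pochhammer q n.
Proof.
rewrite /pochhammer.
elim: n j => [|n IHn] [|j] //= le_jn; rewrite ?big_ord0 ?mul1r ?subn0 //.
rewrite subSS [RHS]big_ord_recr /=.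
have {}IHj := IHn j le_jn.
move: le_jn; rewrite leq_eqVlt ltnS => /predU1P[[eq_jn]|lt_jn].
  move: IHj; rewrite eq_jn (gbinom_small _ (ltnSn n)) subnn big_ord0 expr0 => IHj.
  by rewrite big_ord_recr /= -[in RHS]IHj; ring.
have := IHn j.+1 lt_jn; rewrite !(big_ord_recr j) /= => IHj1.
rewrite -(subnSK lt_jn) in IHj *; rewrite big_ord_recr /= (subnSK lt_jn) in IHj *.
have -> : q ^+ n.+1 = q ^+ (n - j) * q ^+ j.+1.
  by rewrite -exprD addnS subnK // ltnW.
set a := q ^+ (n - j) in IHj *; set b := q ^+ j.+1 in IHj1 *.
set P := \prod_(i < n) _ in IHj IHj1 *.
transitivity (a * (1 - b) * P + (1 - a) * P); last by ring.
by rewrite -{1}IHj -IHj1; ring.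
Qed.
End GaussianBinomials.

(** * The finite Jacobi triple product *)

(** For [s = 0] and [s = 1] the integer [a * (a + s)] is never negative, so the
    absolute value only changes its type. *)
Definition theta_exp (s : nat) (a : int) : nat := `|(a * (a + s%:Z))%R|%N.

Lemma theta_expE (s : nat) a : (s <= 1)%N -> (theta_exp s a)%:Z = a * (a + s%:Z).
Proof. by move=> le_s1; rewrite /theta_exp; case: s le_s1 => [|[|]] // _; nia. Qed.

Lemma sum_double m : (\sum_(i < m) i.*2 = m * m.-1)%N.
Proof.
elim: m => [|n IHn]; first by rewrite big_ord0.
by rewrite big_ord_recr /= IHn; case: (n) => // p; rewrite -muln2; lia.
Qed.

(** The q-binomial theorem in base q^2 with 2m factors y + c q^(2k), where
    y = q^(2m-1-s): the first m factors are q^(2k) (c + q^(2(m-k)-1-s)), the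
    last m are y (1 + c q^(2(k-m)+1+s)), and completing the square on the other
    side turns the exponent of the j-th term into that of index j - m. *)
Lemma finite_triple_product (F : fieldType) (c : F) (s m : nat) :
    (s <= 1)%N -> (0 < m)%N ->
  \prod_(k < m) ((c%:P + 'X^(k.*2.+1 - s)) * (1 + c%:P * 'X^(k.*2.+1 + s))) =
  \sum_(j < m.*2.+1)
    gbinom 'X^2 m.*2 j * c%:P ^+ j * 'X^(theta_exp s (j%:Z - m%:Z)) :> {poly F}.
Proof.
move=> le_s1 m_gt0.
have X0 n : 'X^n != 0 :> {poly F} by rewrite expf_neq0 // polyX_eq0.
pose y := (m.*2.-1 - s)%N.
(* 'X^K collects the powers taken out of the 2m factors. *)
pose K := (m * m.-1 + m * y)%N.
apply: (mulfI (X0 K)).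
have := prod_addr_gbinom ('X^2 : {poly F}) c%:P 'X^y m.*2.
have -> : \prod_(k < m.*2) ('X^y + c%:P * 'X^2 ^+ k) =
    'X^K * \prod_(k < m)
      ((c%:P + 'X^(k.*2.+1 - s)) * (1 + c%:P * 'X^(k.*2.+1 + s))) :> {poly F}.
  rewrite -addnn big_split_ord /= big_split /= /K exprD.
  rewrite [RHS](_ : _ =
    ('X^(m * m.-1) * \prod_(i < m) (c%:P + 'X^(i.*2.+1 - s))) *
    ('X^(m * y) * \prod_(i < m) (1 + c%:P * 'X^(i.*2.+1 + s)))); last by ring.
  congr (_ * _).
    rewrite -sum_double -prodrXr [X in _ = _ * X](reindex_inj rev_ord_inj) /=.
    rewrite -big_split /=.
    apply: eq_bigr => i _; rewrite mulrDr -exprD -exprM addrC mulrC -muln2 mulnC.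
    congr (_ * _ + 'X^ _); rewrite /y; have := ltn_ord i; lia.
  have -> : 'X^(m * y) = \prod_(i < m) 'X^y :> {poly F}.
    by rewrite prodr_const card_ord -exprM mulnC.
  rewrite -big_split /=.
  apply: eq_bigr => i _; rewrite mulrDr mulr1 mulrCA -exprD -exprM.
  congr (_ + _ * 'X^ _); rewrite /y; have := ltn_ord i; lia.
move=> ->; rewrite mulr_sumr; apply: eq_bigr => j _.
rewrite -!exprM -!mulrA [in RHS]mulrCA; congr (_ * _).
rewrite [LHS]mulrCA [RHS]mulrCA; congr (_ * _).
rewrite -!exprD; congr 'X^ _.
have eC : ('C(j, 2) * 2 = j * j.-1)%N.
  rewrite bin2 muln2 halfK; case: (nat_of_ord j) => // k.
  by rewrite oddM /= andNb subn0.
have := ltn_ord j; have /= := theta_expE (j%:Z - m%:Z) le_s1; move: eC.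
rewrite /K /y; case: m m_gt0 {X0 K y} j => // p _ j.
move: (theta_exp _ _) => e; move: 'C(j, 2) => C; move: (nat_of_ord j) => {}j.
case: s le_s1 => [|[|]] // _; case: j => [|j]; nia.
Qed.

(** * Truncated power series *)

Section TruncatedSeries.
Variable F : fieldType.
Implicit Types p q u v : {poly F}.

Definition congX M p q := 'X^M %| p - q.

Lemma eq_congX M p p' q q' :
  p = p' -> q = q' -> congX M p q -> congX M p' q'.
Proof. by move=> -> ->. Qed.

Lemma congX_refl M p : congX M p p.
Proof. by rewrite /congX subrr dvdp0. Qed.

Lemma congX_sym M p q : congX M p q -> congX M q p.
Proof. by rewrite /congX -dvdpNr opprB. Qed.

Lemma congX_trans M q p u : congX M p q -> congX M q u -> congX M p u.
Proof. by rewrite /congX => pq qu; rewrite -(subrKA q) dvdp_add. Qed.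

Lemma congXD M p q u v : congX M p q -> congX M u v -> congX M (p + u) (q + v).
Proof. by rewrite /congX => pq uv; rewrite opprD addrACA dvdp_add. Qed.

Lemma congXN M p q : congX M p q -> congX M (- p) (- q).
Proof. by rewrite /congX -opprD dvdpNr. Qed.

Lemma congXM M p q u v : congX M p q -> congX M u v -> congX M (p * u) (q * v).
Proof.
rewrite /congX => pq uv.
have -> : p * u - q * v = (p - q) * u + q * (u - v) by ring.
by apply: dvdp_add; [apply: dvdp_mulr | apply: dvdp_mull].
Qed.

Lemma congXX M p q n : congX M p q -> congX M (p ^+ n) (q ^+ n).
Proof.
move=> pq; elim: n => [|n IHn]; first exact: congX_refl.
by rewrite !exprS congXM.
Qed.

Lemma congX_sum M (I : Type) (r : seq I) (P : pred I) (f g : I -> {poly F}) :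
  (forall i, P i -> congX M (f i) (g i)) ->
  congX M (\sum_(i <- r | P i) f i) (\sum_(i <- r | P i) g i).
Proof.
move=> fg; apply: (big_ind2 (congX M)) => //; first exact: congX_refl.
by move=> *; apply: congXD.
Qed.

Lemma congX_mulXn M p n : (M <= n)%N -> congX M (p * 'X^n) 0.
Proof. by move=> leMn; rewrite /congX subr0 dvdp_mull ?dvdp_exp2l. Qed.

(** A polynomial with nonzero constant term is a unit modulo 'X^M. *)
Lemma congX_cancel M u p q :
  u.[0] != 0 -> congX M (u * p) (u * q) -> congX M p q.
Proof.
move=> u0; rewrite /congX -mulrBr Gauss_dvdpr // coprimep_expl //.
by rewrite coprimep_sym coprimepX /root.
Qed.

Lemma congX_coef M p q i : congX M p q -> (i < M)%N -> p`_i = q`_i.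
Proof.
move=> /dvdpP[r /eqP]; rewrite subr_eq => /eqP -> lt_iM.
by rewrite coefD coefMXn lt_iM add0r.
Qed.

(** The substitute for convergence of an infinite product. *)
Lemma congX_prod_tail M (f : nat -> {poly F}) n :
  (forall k, (M <= k)%N -> congX M (f k) 1) -> (M <= n)%N ->
  congX M (\prod_(k < n) f k) (\prod_(k < M) f k).
Proof.
move=> f1 /subnKC <-; elim: (n - M)%N => [|d IHd].
  by rewrite addn0 congX_refl.
rewrite addnS big_ord_recr /= -[X in congX _ _ X]mulr1.
by apply: congXM => //; apply: f1; apply: leq_addr.
Qed.

Lemma congX_1DXn M (c : F) n : (M <= n)%N -> congX M (1 + c%:P * 'X^n) 1.
Proof.
move=> leMn; rewrite -[X in congX _ _ X]addr0; apply: congXD (congX_refl _ _) _.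
exact: congX_mulXn.
Qed.

Lemma congX_pochhammer M n : (M <= n)%N ->
  congX M (pochhammer ('X^2 : {poly F}) n) (pochhammer 'X^2 M).
Proof.
apply: (@congX_prod_tail M (fun k => 1 - 'X^2 ^+ k.+1)) => k leMk.
rewrite -exprM -[- _]mul1r mulrN -mulNr -polyCN.
by apply: congX_1DXn; lia.
Qed.

Lemma horner0_pochhammer n : (pochhammer ('X^2 : {poly F}) n).[0] = 1.
Proof.
rewrite /pochhammer horner_prod big1 // => i _.
by rewrite !hornerE -exprM expr0n subr0.
Qed.

(** Far from both ends of its row, the Gaussian binomial in base q^2 agrees with
    the inverse of prod (1 - q^(2k+2)). *)
Lemma congX_gbinom M m n j : (M <= m)%N -> (M <= j)%N -> (j + M <= n)%N ->
  congX M (pochhammer ('X^2 : {poly F}) m * gbinom 'X^2 n j) 1.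
Proof.
move=> leMm leMj lejn; pose u : {poly F} := pochhammer 'X^2 M.
apply: (@congX_cancel _ (pochhammer 'X^2 (n - j))).
  by rewrite horner0_pochhammer oner_neq0.
have le_jn : (j <= n)%N by lia.
have le_M_nj : (M <= n - j)%N by lia.
have le_Mn : (M <= n)%N by lia.
have E := pochhammer_gbinom ('X^2 : {poly F}) le_jn.
rewrite mulr1; apply: (congX_trans (q := u)); last exact/congX_sym/congX_pochhammer.
apply: (congX_trans (q := pochhammer 'X^2 n)); last exact: congX_pochhammer.
rewrite -E.
pose t := gbinom 'X^2 n j * pochhammer ('X^2 : {poly F}) (n - j).
rewrite [X in congX _ X _](_ : _ = pochhammer 'X^2 m * t); last by rewrite /t; ring.
rewrite [X in congX _ _ X](_ : _ = pochhammer 'X^2 j * t); last by rewrite /t; ring.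
apply: congXM; last exact: congX_refl.
exact: congX_trans (congX_pochhammer leMm) (congX_sym (congX_pochhammer leMj)).
Qed.
End TruncatedSeries.

(** * Theta series *)

Definition window m : seq int := [seq j%:Z - m%:Z | j <- iota 0 m.*2.+1].

(** Only [c = 1] and [c = -1] are of interest, for which the absolute value in the
    exponent agrees with the power c^a of the two-sided series. *)
Definition theta (F : fieldType) (c : F) s m : {poly F} :=
  \sum_(a <- window m) (c ^+ `|a|)%:P * 'X^(theta_exp s a).

(** Multiplying [finite_triple_product] by prod (1 - q^(2k+2)) makes each
    Gaussian binomial congruent to 1, except near the ends of the row, where the
    accompanying power of q already vanishes: [m = 2M] leaves room for both, and
    makes [c ^+ j] depend only on the distance from [j] to [m]. *)
Lemma truncated_triple_product (F : fieldType) (c : F) s M m :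
    (s <= 1)%N -> c ^+ 2 = 1 -> (0 < M)%N -> m = M.*2 ->
  congX M
    (pochhammer 'X^2 m *
     \prod_(k < m) ((c%:P + 'X^(k.*2.+1 - s)) * (1 + c%:P * 'X^(k.*2.+1 + s))))
    (theta c s m).
Proof.
move=> le_s1 c2 M_gt0 mE; rewrite finite_triple_product; [|lia..].
rewrite /theta /window big_map -(subn0 m.*2.+1) -/(index_iota _ _) big_mkord.
rewrite subn0 mulr_sumr.
apply: congX_sum => j _; rewrite -mulrA mulrA.
have -> : c%:P ^+ j = (c ^+ `|(j%:Z - m%:Z)%R|)%:P :> {poly F}.
  rewrite -rmorphXn /=; congr _%:P.
  have cE n : c ^+ n = c ^+ odd n.
    by rewrite -[in LHS](odd_double_half n) exprD -mul2n exprM c2 expr1n mulr1.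
  have ev_m : ~~ odd m by rewrite mE odd_double.
  by rewrite [LHS]cE [RHS]cE; congr (c ^+ nat_of_bool _); lia.
set a : int := _ - _.
have [leM|ltM] := leqP M (theta_exp s a).
  rewrite mulrA; apply: congX_trans (congX_mulXn _ leM) _.
  exact: congX_sym (congX_mulXn _ leM).
have aM : (-(M%:Z) <= a <= M%:Z)%R.
  have := theta_expE a le_s1; move: ltM; clear -le_s1.
  case: s le_s1 => [|[|]] // _; move: (theta_exp _ _) => e ?; nia.
have gbinom1 : congX M (pochhammer ('X^2 : {poly F}) m * gbinom 'X^2 m.*2 j) 1.
  by apply: congX_gbinom; rewrite /a in aM; lia.
set t := _%:P * 'X^_.
by have := congXM gbinom1 (congX_refl M t); rewrite mul1r.
Qed.

(** * Jacobi's quartic identity for theta series *)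

(** Changes of summation variable need not respect the cut-off of the index
    sets: it suffices that every index of weight below [M] is listed. *)
Lemma congX_reindex (F : fieldType) M (T1 T2 : eqType)
    (h : T1 -> T2) (g : T2 -> T1)
    (s1 : seq T1) (s2 : seq T2) (P1 : pred T1) (P2 : pred T2)
    (e1 : T1 -> nat) (e2 : T2 -> nat) :
    uniq s1 -> uniq s2 ->
    (forall x, (e1 x < M)%N -> x \in s1) -> (forall y, (e2 y < M)%N -> y \in s2) ->
    (forall x, P1 x -> [/\ P2 (h x), e2 (h x) = e1 x & g (h x) = x]) ->
    (forall y, P2 y -> P1 (g y) /\ h (g y) = y) ->
  congX M (\sum_(x <- s1 | P1 x) 'X^(e1 x) : {poly F})
          (\sum_(y <- s2 | P2 y) 'X^(e2 y)).
Proof.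
move=> Us1 Us2 s1P s2P hP gP.
have small (T : eqType) (s : seq T) (P : pred T) (e : T -> nat) :
    congX M (\sum_(x <- s | P x) 'X^(e x) : {poly F})
            (\sum_(x <- [seq x <- s | P x && (e x < M)%N]) 'X^(e x)).
  rewrite big_filter big_mkcondr /=; apply: congX_sum => x _.
  case: ltnP => [_|leM]; first exact: congX_refl.
  by rewrite -['X^_]mul1r; apply: congX_mulXn.
apply: congX_trans (small _ _ _ _) (congX_trans _ (congX_sym (small _ _ _ _))).
set s2' := [seq y <- s2 | _]; set s1' := [seq x <- s1 | _].
have eq_s2' : perm_eq s2' (map h s1').
  apply: uniq_perm; first exact: filter_uniq.
    rewrite map_inj_in_uniq ?filter_uniq // => x y.
    rewrite !mem_filter => /andP[/andP[/hP[_ _ gx] _] _].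
    move=> /andP[/andP[/hP[_ _ gy] _] _] eq_h.
    by rewrite -gx eq_h.
  move=> y; apply/idP/mapP => [|[x + ->]]; rewrite !mem_filter.
    case/andP=> /andP[/gP[P1y hy] lt_y] _; exists (g y); last by rewrite hy.
    have [_ ey _] := hP _ P1y; rewrite hy in ey.
    by rewrite mem_filter P1y -ey lt_y s1P // -ey.
  by case/andP=> /andP[/hP[-> ehx _] lt_x] _; rewrite ehx lt_x s2P // ehx.
rewrite (perm_big _ eq_s2') big_map.
suff -> : \sum_(x <- s1') 'X^(e2 (h x)) = \sum_(x <- s1') 'X^(e1 x) :> {poly F}.
  exact: congX_refl.
rewrite !big_seq; apply: eq_bigr => x.
by rewrite mem_filter => /andP[/andP[/hP[_ -> _]]].
Qed.

Notation vec4 := ((int * int) * (int * int))%type.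

Definition box4 m : seq vec4 :=
  let w2 := [seq (a, b) | a <- window m, b <- window m] in
  [seq (u, v) | u <- w2, v <- w2].

Definition weight s (v : vec4) : nat :=
  (theta_exp s v.1.1 + theta_exp s v.1.2
   + (theta_exp s v.2.1 + theta_exp s v.2.2))%N.

Definition odd_sum (v : vec4) : bool :=
  odd (`|v.1.1| + `|v.1.2| + (`|v.2.1| + `|v.2.2|))%N.

Lemma mem_window m (a : int) : (a \in window m) = (`|a| <= m)%N.
Proof.
apply/mapP/idP => [[j]|le_am]; first by rewrite mem_iota => ? ->; lia.
by exists `|(a + m%:Z)%R|%N; rewrite ?mem_iota; lia.
Qed.

Lemma window_uniq m : uniq (window m).
Proof. by rewrite map_inj_uniq ?iota_uniq // => i j /=; lia. Qed.

Lemma box4_uniq m : uniq (box4 m).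
Proof.
have pair_inj (T : eqType) (r : seq (T * T)) :
    {in r &, injective (uncurry (@pair T T))}.
  by move=> [? ?] [? ?] _ _.
by rewrite !allpairs_uniq ?window_uniq.
Qed.

Lemma mem_box4 s m v : (s <= 1)%N -> (weight s v < m)%N -> v \in box4 m.
Proof.
move=> le_s1; case: v => -[a b] [c d]; rewrite /weight /= => lt_m.
have memw x : (theta_exp s x < m)%N -> x \in window m.
  rewrite mem_window; have := theta_expE x le_s1.
  by case: s le_s1 {lt_m} => [|[|]] // _; move: (theta_exp _ _) => n; nia.
by do !apply: allpairs_f; apply: memw; lia.
Qed.

Lemma theta_exp4 (F : fieldType) (c : F) s m :
  theta c s m ^+ 4 =
  \sum_(v <- box4 m)
    (c ^+ (`|v.1.1| + `|v.1.2| + (`|v.2.1| + `|v.2.2|)))%:P * 'X^(weight s v).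
Proof.
pose f a : {poly F} := (c ^+ `|a|)%:P * 'X^(theta_exp s a).
have mul_sum (I J : Type) (r : seq I) (t : seq J)
    (p : I -> {poly F}) (q : J -> {poly F}) :
    (\sum_(i <- r) p i) * (\sum_(j <- t) q j) =
    \sum_(u <- [seq (i, j) | i <- r, j <- t]) p u.1 * q u.2.
  by rewrite big_allpairs mulr_suml; apply: eq_bigr => i _; rewrite mulr_sumr.
rewrite /theta -/f -[4%N]/(2 * 2)%N exprM !expr2 !mul_sum; apply: eq_bigr => v _.
by rewrite /f /weight !exprD !rmorphM /=; ring.
Qed.

Lemma theta_diff_odd_sum (F : fieldType) m :
  theta 1 0 m ^+ 4 - theta (-1) 0 m ^+ 4 =
  (\sum_(v <- box4 m | odd_sum v) 'X^(weight 0 v)) *+ 2 :> {poly F}.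
Proof.
rewrite !theta_exp4 -sumrB [in RHS]big_mkcond -sumrMnl; apply: eq_bigr => v _.
rewrite expr1n -signr_odd -/(odd_sum v).
by case: odd_sum; rewrite /= ?expr1 ?expr0 ?polyCN; ring.
Qed.

(** A vector [y] stands for x = y + (1/2, 1/2, 1/2, 1/2), so that [weight 1 y]
    is |x|^2 - 1.  The image of [v] under the isometry of the header is
    integral after subtraction of the 1/2's when [v] has odd sum; its first
    coordinate [k] determines the others, e.g. (a+b-c-d-1)/2 = a+b-k-1. *)
Definition to_half_odd (v : vec4) : vec4 :=
  let: ((a, b), (c, d)) := v in let k := ((a + b + c + d) %/ 2)%Z in
  ((k, a + b - k - 1), (a + c - k - 1, a + d - k - 1)).

(** The isometry is an involution; [t + 1] is half the coordinate sum of the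
    shifted vector. *)
Definition of_half_odd (y : vec4) : vec4 :=
  let: ((a, b), (c, d)) := y in let t := ((a + b + c + d) %/ 2)%Z in
  ((t + 1, a + b - t), (a + c - t, a + d - t)).

(** The sign change x_1 -> -x_1 of the shifted vector. *)
Definition reflect1 (y : vec4) : vec4 := ((- 1 - y.1.1, y.1.2), y.2).

Lemma weightE s v : (s <= 1)%N -> (weight s v)%:Z =
  v.1.1 * (v.1.1 + s%:Z) + v.1.2 * (v.1.2 + s%:Z)
  + (v.2.1 * (v.2.1 + s%:Z) + v.2.2 * (v.2.2 + s%:Z)).
Proof. by move=> le_s1; rewrite /weight !PoszD !theta_expE. Qed.

Lemma odd_to_half_odd v : odd_sum v ->
  [/\ ~~ odd_sum (to_half_odd v), (weight 1 (to_half_odd v)).+1 = weight 0 v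
    & of_half_odd (to_half_odd v) = v].
Proof.
case: v => -[a b] [c d]; rewrite /odd_sum /= => odd_v.
have [k dE] : exists k : int, d = 2 * k + 1 - a - b - c.
  by exists ((a + b + c + d) %/ 2)%Z; lia.
have kE : ((a + b + c + d) %/ 2)%Z = k by lia.
rewrite kE; split.
- lia.
- apply/eqP; rewrite -eqz_nat -addn1 PoszD !weightE //= dE; apply/eqP; ring.
- have -> : ((k + (a + b - k - 1) + (a + c - k - 1) + (a + d - k - 1)) %/ 2)%Z =
      a - 1 by lia.
  by do 2!congr (_, _); lia.
Qed.

Lemma even_of_half_odd y : ~~ odd_sum y ->
  odd_sum (of_half_odd y) /\ to_half_odd (of_half_odd y) = y.
Proof.
case: y => -[a b] [c d]; rewrite /odd_sum /= => ev_y.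
have [t tE] : exists t : int, ((a + b + c + d) %/ 2)%Z = t by eexists.
rewrite tE; split; first by lia.
have -> : ((t + 1 + (a + b - t) + (a + c - t) + (a + d - t)) %/ 2)%Z = a by lia.
by do 2!congr (_, _); lia.
Qed.

(** The right side runs over all half-odd vectors, and [to_half_odd] matches the
    odd-sum vectors with one parity class of them, [reflect1 \o to_half_odd]
    with the other. *)
Lemma jacobi_quartic (F : fieldType) M m : (M <= m)%N ->
  congX M (theta 1 0 m ^+ 4 - theta (-1) 0 m ^+ 4 : {poly F})
          ('X * theta 1 1 m ^+ 4).
Proof.
move=> leMm; rewrite theta_diff_odd_sum theta_exp4 mulr_sumr.
rewrite [X in congX _ _ X](eq_bigr (fun v => 'X^((weight 1 v).+1))) =>
  [|v _]; last first.
  by rewrite expr1n mul1r exprS.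
rewrite [X in congX _ _ X](bigID odd_sum) /= mulr2n.
have inbox s k v : (s <= 1)%N -> (k + weight s v < M)%N -> v \in box4 m.
  by move=> le_s1 lt_M; apply: (mem_box4 le_s1); lia.
apply: congXD; last first.
  apply: (@congX_reindex F M _ _ to_half_odd of_half_odd); try exact: box4_uniq.
  - by move=> v; apply: (inbox 0%N 0%N).
  - by move=> v; apply: (inbox 1%N 1%N).
  - exact: odd_to_half_odd.
  - exact: even_of_half_odd.
have reflectK : involutive reflect1.
  by move=> [[a b] [c d]]; rewrite /reflect1 /=; do 2!congr (_, _); lia.
have odd_reflect y : odd_sum (reflect1 y) = ~~ odd_sum y.
  by case: y => -[a b] [c d]; rewrite /odd_sum /=; lia.
have weight_reflect y : weight 1 (reflect1 y) = weight 1 y.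
  by apply/eqP; rewrite -eqz_nat !weightE //=; apply/eqP; ring.
apply: (@congX_reindex F M _ _ (reflect1 \o to_half_odd) (of_half_odd \o reflect1));
  try exact: box4_uniq.
- by move=> v; apply: (inbox 0%N 0%N).
- by move=> v; apply: (inbox 1%N 1%N).
- move=> v /odd_to_half_odd[ev ew eK]; rewrite /comp.
  by rewrite odd_reflect weight_reflect reflectK.
- move=> y /= odd_y; have /even_of_half_odd[-> ->] : ~~ odd_sum (reflect1 y).
    by rewrite odd_reflect odd_y.
  by rewrite reflectK.
Qed.

(** * Product identities *)

Section Products.
Variable F : fieldType.

Definition odd_prod (c : F) m : {poly F} := \prod_(k < m) (1 + c%:P * 'X^(k.*2.+1)).
Definition even_prod m : {poly F} := \prod_(k < m) (1 + 'X^(k.*2.+2)).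

Lemma odd_even_prod e o m :
  \prod_(k < m.*2) (1 + 'X^(k.+1)) ^+ (if odd k.+1 then o else e) =
  odd_prod 1 m ^+ o * even_prod m ^+ e.
Proof.
rewrite /odd_prod /even_prod; elim: m => [|m IHm].
  by rewrite !big_ord0 !expr1n mulr1.
rewrite doubleS !big_ord_recr /= IHm odd_double /= mul1r !exprMn.
set a := _ ^+ o; set b := _ ^+ e; set a' := _ ^+ o; set b' := _ ^+ e; ring.
Qed.

(** A finite form of Euler's identity: the factors on the left are 1 - q^n and
    1 + q^n for all n <= 2m, sorted by the parity of n. *)
Lemma euler_pochhammer m :
  pochhammer 'X^2 m * (odd_prod 1 m * odd_prod (-1) m * even_prod m) =
  pochhammer 'X^2 m.*2.
Proof.
rewrite /odd_prod /even_prod /pochhammer; elim: m => [|m IHm].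
  by rewrite !big_ord0 !mulr1.
have sq n : 'X^2 ^+ n = 'X^n * 'X^n :> {poly F}.
  by rewrite -exprM mul2n -addnn exprD.
have sq1 : 'X^2 ^+ m.+1 = 'X^(m.*2.+2) :> {poly F} by rewrite -exprM mul2n doubleS.
by rewrite doubleS !big_ord_recr /= -IHm polyCN sq1 !sq; ring.
Qed.

Section TripleProductInstances.
Variables (M m : nat).
Hypotheses (M_gt0 : (0 < M)%N) (mE : m = M.*2).

Lemma euler_congX : congX M (odd_prod 1 m * odd_prod (-1) m * even_prod m) 1.
Proof.
apply: (@congX_cancel _ _ (pochhammer 'X^2 m)).
  by rewrite horner0_pochhammer oner_neq0.
rewrite euler_pochhammer mulr1.
apply: congX_trans (congX_sym (congX_pochhammer _ _)); last by lia.
by apply: congX_pochhammer; lia.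
Qed.

Lemma theta3_prod :
  congX M (pochhammer 'X^2 m * odd_prod 1 m ^+ 2) (theta 1 0 m).
Proof.
have := truncated_triple_product (s := 0) (leq0n _) (expr1n F 2) M_gt0 mE.
apply: eq_congX => //; congr (_ * _).
rewrite expr2 /odd_prod -big_split /=; apply: eq_bigr => k _.
by rewrite subn0 addn0 mul1r.
Qed.

Lemma theta4_prod :
  congX M (pochhammer 'X^2 m * odd_prod (-1) m ^+ 2) (theta (-1) 0 m).
Proof.
have c2 : (-1) ^+ 2 = 1 :> F by rewrite sqrrN expr1n.
have := truncated_triple_product (s := 0) (leq0n _) c2 M_gt0 mE.
apply: eq_congX => //; congr (_ * _).
pose f k : {poly F} := 1 + (-1)%:P * 'X^(k.*2.+1).
rewrite (eq_bigr (fun k : 'I_m => -1 * (f k * f k))) => [|k _]; last first.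
  by rewrite /f subn0 addn0 polyCN; ring.
(* The m signs cancel because m is even. *)
rewrite !big_split /= prodr_const card_ord -signr_odd mE odd_double mul1r.
by rewrite expr2.
Qed.

Lemma theta2_prod :
  congX M (pochhammer 'X^2 m * even_prod m ^+ 2 *+ 2) (theta 1 1 m).
Proof.
have := truncated_triple_product (s := 1) (leqnn _) (expr1n F 2) M_gt0 mE.
rewrite big_split /=.
set u := \prod_(i < m) _; set v := \prod_(i < m) _.
have -> : v = even_prod m by apply: eq_bigr => k _; rewrite mul1r addn1.
suff u2 : congX M (even_prod m *+ 2) u.
  apply: congX_trans.
  rewrite (_ : _ *+ 2 =
    pochhammer 'X^2 m * ((even_prod m *+ 2) * even_prod m)); last by ring.
  exact: congXM (congX_refl _ _) (congXM u2 (congX_refl _ _)).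
have tail n : (M <= n)%N -> congX M (even_prod n) (even_prod M).
  apply: (@congX_prod_tail _ M (fun k => 1 + 'X^(k.*2.+2))) => k leMk.
  by rewrite -['X^_]mul1r; apply: congX_1DXn; lia.
(* The factor of index 0 is 1 + q^0 = 2; the others are those of [even_prod]. *)
have uE : u = even_prod m.-1 *+ 2.
  rewrite /u; have : (0 < m)%N by lia.
  case: (m) => // n _.
  rewrite big_ord_recl /= double0 subn1 expr0 mulr2n mulrDl mul1r.
  by congr (_ + _); apply: eq_bigr => k _; rewrite subn1.
have tails : congX M (even_prod m) (even_prod m.-1).
  by apply: congX_trans (tail _ _) (congX_sym (tail _ _)); lia.
by rewrite uE !mulr2n; apply: congXD.
Qed.

(** Jacobi's aequatio identica satis abstrusa: with the products substituted for
    the theta series, [jacobi_quartic] has the common factor [pochhammer ^+ 4]. *)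
Lemma jacobi_abstruse :
  congX M (odd_prod 1 m ^+ 8 - odd_prod (-1) m ^+ 8) ('X * even_prod m ^+ 8 *+ 16).
Proof.
apply: (@congX_cancel _ _ (pochhammer 'X^2 m ^+ 4)).
  by rewrite horner_exp horner0_pochhammer expr1n oner_neq0.
have th3 := congXX 4 theta3_prod.
have th4 := congXX 4 theta4_prod.
have th2 := congXM (congX_refl M 'X) (congXX 4 theta2_prod).
have leMm : (M <= m)%N by lia.
have := congX_trans (congXD th3 (congXN th4))
  (congX_trans (jacobi_quartic F leMm) (congX_sym th2)).
apply: eq_congX; ring.
Qed.

(** Multiplying Jacobi's identity by O^8 P^8 turns N^8 into (O N P)^8 = 1. *)
Lemma copies_gf_identity :
  congX M (odd_prod 1 m ^+ 16 * even_prod m ^+ 8)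
          (1 + 'X * (odd_prod 1 m ^+ 8 * even_prod m ^+ 16) *+ 16).
Proof.
have abstruse_mul :=
  congXM jacobi_abstruse (congX_refl M (odd_prod 1 m ^+ 8 * even_prod m ^+ 8)).
have := congXD (congXX 8 euler_congX) abstruse_mul; rewrite expr1n.
apply: eq_congX; ring.
Qed.
End TripleProductInstances.
End Products.

(** * Generating function of the partitions *)

Section ColoredBox.
Variables (e o L C : nat).
Hypotheses (le_eC : (e <= C)%N) (le_oC : (o <= C)%N).
Local Notation box := ('I_L * 'I_C)%type.

(** Values at most [L] suffice for partitions of [N <= L], so the relevant colored
    integers are indexed by the finite type [box]; its first coordinate is the
    value minus one. *)
Definition colored_of_box (i : box) : colored := (i.1.+1, nat_of_ord i.2).

Definition fset_of_box (A : {set box}) : {fset colored} :=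
  [fset colored_of_box i | i in A]%fset.

Definition box_copies : {set box} :=
  [set i : box | (i.2 < if odd i.1.+1 then o else e)%N].

Lemma colored_of_box_inj : injective colored_of_box.
Proof. by move=> [a b] [c d] [/val_inj -> /val_inj ->]. Qed.

Lemma mem_fset_of_box A i : (colored_of_box i \in fset_of_box A) = (i \in A).
Proof. by rewrite mem_imfset //; exact: colored_of_box_inj. Qed.

Lemma fset_of_box_inj : injective fset_of_box.
Proof. by move=> A B eqAB; apply/setP => i; rewrite -!mem_fset_of_box eqAB. Qed.

Lemma sum_fset_of_box A :
  (\sum_(x <- fset_of_box A) value x = \sum_(i in A) i.1.+1)%N.
Proof.
rewrite (perm_big [seq colored_of_box i | i <- enum A]).
  by rewrite big_map big_enum.
apply: uniq_perm; first exact: fset_uniq.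
  by rewrite map_inj_uniq ?enum_uniq //; exact: colored_of_box_inj.
move=> x; apply/imfsetP/mapP => -[i iA ->]; exists i => //; move: iA;
  by rewrite mem_enum.
Qed.

Lemma num_distinct_partitions_box N : (N <= L)%N ->
  num_distinct_partitions (copies e o) N =
  #|[set A : {set box} | A \subset box_copies & (\sum_(i in A) i.1.+1 == N)%N]|.
Proof.
move=> le_NL; rewrite /num_distinct_partitions.
set Q := [set A | _].
have -> : fset_set (distinct_partitions (copies e o) N) =
    [fset fset_of_box A | A in Q]%fset.
  apply/fsetP => P; rewrite in_fset_set; last exact: finite_distinct_partitions.
  apply/idP/imfsetP => [|[A + ->]]; rewrite !inE /=; last first.
    case/andP=> /fintype.subsetP sA /eqP sum_A.
    split; last by rewrite sum_fset_of_box.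
    by move=> x /= /imfsetP[i /sA + ->]; rewrite inE.
  case=> PX sum_P.
  have in_box x : x \in P -> exists i, x = colored_of_box i.
    move=> xP; have /= [x_gt0 lt_col] := PX x xP.
    have lt_val : ((value x).-1 < L)%N.
      rewrite prednK //; apply: leq_trans le_NL.
      by rewrite -sum_P (big_fsetD1 _ xP) leq_addr.
    have lt_colC : (color x < C)%N by apply: leq_trans lt_col _; case: ifP.
    exists (Ordinal lt_val, Ordinal lt_colC).
    by rewrite /colored_of_box /= prednK //; case: (x).
  pose A := [set i : box | colored_of_box i \in P].
  have PE : P = fset_of_box A.
    apply/fsetP => x; apply/idP/imfsetP => [xP|[j + ->]]; last by rewrite inE.
    by have [j xE] := in_box x xP; exists j; rewrite // inE -xE.
  exists A => //; rewrite !inE -sum_fset_of_box -PE sum_P eqxx andbT.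
  by apply/fintype.subsetP => j; rewrite !inE => /PX[].
rewrite card_imfset; last exact: fset_of_box_inj.
by rewrite /= -cardE.
Qed.

Lemma coef_prod_box (R : comNzRingType) N :
  (\prod_(i : box) (1 + if i \in box_copies then 'X^(i.1.+1) else 0)
    : {poly R})`_N =
  #|[set A : {set box} | A \subset box_copies & (\sum_(i in A) i.1.+1 == N)%N]|%:R.
Proof.
under eq_bigr => i _ do rewrite addrC.
rewrite bigA_distr coef_sum -sum1_card natr_sum [RHS]big_mkcond /=.
apply: eq_bigr => A _.
rewrite -big_mkcond /= inE.
have [sA|/subsetPn[i iA iB]] := boolP (A \subset box_copies); last first.
  by rewrite (bigD1 i) //= (negbTE iB) mul0r coef0.
rewrite (eq_bigr (fun i : box => 'X^(i.1.+1))) =>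
  [|i /(fintype.subsetP sA) -> //].
by rewrite prodrXr coefXn eq_sym; case: eqP.
Qed.

Lemma prod_box (R : comNzRingType) :
  \prod_(i : box) (1 + if i \in box_copies then 'X^(i.1.+1) else 0) =
  \prod_(k < L) (1 + 'X^(k.+1)) ^+ (if odd k.+1 then o else e) :> {poly R}.
Proof.
transitivity (\prod_(k < L) \prod_(c < C)
    (1 + if (k, c) \in box_copies then 'X^(k.+1) else 0) : {poly R}).
  by rewrite pair_bigA /=; apply: eq_bigr => -[].
apply: eq_bigr => k _; set b := if odd _ then _ else _.
have le_bC : (b <= C)%N by rewrite /b; case: ifP.
rewrite (eq_bigr (fun c : 'I_C => if (c < b)%N then 1 + 'X^(k.+1) else 1)) =>
  [|c _]; last first.
  by rewrite inE /= -/b; case: ifP; rewrite ?addr0.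
rewrite -big_mkcond -(big_ord_widen _ (fun _ => 1 + 'X^(k.+1)) le_bC).
by rewrite prodr_const card_ord.
Qed.
End ColoredBox.

(** Each available copy of n contributes a factor 1 + q^n; the bound 16 is only
    the number of colors reserved in the index type. *)
Lemma num_distinct_partitions_gf (F : fieldType) e o m N :
    (e <= 16)%N -> (o <= 16)%N -> (N <= m.*2)%N ->
  (num_distinct_partitions (copies e o) N)%:R =
  (odd_prod 1 m ^+ o * even_prod F m ^+ e)`_N.
Proof.
move=> le_e le_o le_N.
rewrite (num_distinct_partitions_box le_e le_o le_N) -coef_prod_box.
by rewrite prod_box // odd_even_prod.
Qed.

(** * The identity between the two partition functions *)

Local Close Scope ring_scope.

Theorem theorem3p4 (N : nat) (hN : 1 <= N) : D_S N = 16 * D_T (N - 1).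
Proof.
pose m := N.+1.*2.
have gf e o n : (e <= 16) -> (o <= 16) -> (n <= N) ->
    ((num_distinct_partitions (copies e o) n)%:R =
     (odd_prod 1 m ^+ o * even_prod rat m ^+ e)`_n)%R.
  by move=> le_e le_o le_nN; apply: num_distinct_partitions_gf; rewrite // /m; lia.
have := congX_coef (copies_gf_identity rat (ltn0Sn N) (erefl m)) (ltnSn N).
rewrite -gf // coefD coef1 coefMn coefXM.
case: N hN => // N _ in m gf *; rewrite add0r /= -gf //.
by rewrite -mulrnA => /eqP; rewrite Num.Theory.eqr_nat subn1 mulnC => /eqP.
Qed.
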